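(* Let $n\ge 1$ and $\pi\in S_n$. Consider the construction of the Robinson–Schensted pair $(P,Q)$ of $\pi$ by Viennot's method of shadows. Then $\mathrm{bump}(\pi)$ equals the total number of intermediate points that appear in all of the shadows (that is, the sum over $r\ge 1$ of the number of intermediate points of the $r$th shadows of $\pi$).
   Context: $S_n$ is the set of permutations $\pi=\pi_1\cdots\pi_n$ (one-line notation) of $\{1,\ldots,n\}$. Robinson–Schensted (RS) correspondence: tableaux are fillings of Young diagrams with distinct positive integers increasing along rows and down columns. To insert $k$ into a tableau $P$ (written $P\leftarrow k$), start with the top row: (I1) if $k$ is greater than or equal to the rightmost entry of the current row, or the current row is empty, append $k$ at the end of that row and stop; (I2) otherwise let $y$ be the leftmost entry of the current row with $k<y$, replace $y$ by $k$ (this is one bump), set $k:=y$, move down one row and go to (I1). For $\pi\in S_n$, start with the pair $(P_0,Q_0)$ of empty tableaux and for $i=0,\ldots,n-1$ let $P_{i+1}=P_i\leftarrow\pi_{i+1}$ and form $Q_{i+1}$ from $Q_i$ by placing $i+1$ in the cell of $P_{i+1}$ not in $P_i$; $(P,Q)=(P_n,Q_n)$. The statistic $\mathrm{bump}(\pi)$ is the total number of bumps that occur when the RS procedure is applied to $\pi$. Viennot's shadows: Let $G_1=\{(i,\pi_i): 1\le i\le n\}$ in the plane. For a finite set $G$ of points with distinct $x$-coordinates and distinct $y$-coordinates, extend from each point of $G$ a line north and a line east until they encounter other such lines or leave the $n\times n$ grid; these form the shadow lines of $G$. Explicitly: the first shadow line is the staircase boundary of $\bigcup_{(a,b)\in G}\{(x,y):x\ge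 a,\ y\ge b\}$; remove from $G$ the points lying on it and repeat with the remaining points to obtain the second shadow line, and so on until no points remain. The intermediate points of $G$ are the corners of the shadow lines that are not points of $G$: if the points of $G$ on a given shadow line are $(x_1,y_1),\ldots,(x_m,y_m)$ with $x_1<\cdots<x_m$ and $y_1>\cdots>y_m$, then the intermediate points on that line are $(x_{j+1},y_j)$ for $1\le j\le m-1$. The $r$th shadows of $\pi$ are the shadow lines of $G_r$, where for $r\ge 1$ the set $G_{r+1}$ is the set of all intermediate points of $G_r$; the process stops when $G_r$ is empty. (Row $r$ of $P$, respectively $Q$, consists of the $y$-coordinates, respectively $x$-coordinates, at which the $r$th shadow lines leave the grid on the right, respectively at the top.) *)

(* Defs.v *)
From mathcomp Require Import all_boot all_order all_algebra all_fingroup.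
From mathcomp Require Import all_classical all_reals topology normedtype.
Import Order.TTheory GRing.Theory Num.Theory numFieldNormedType.Exports.

Set Implicit Arguments.
Unset Strict Implicit.
Unset Printing Implicit Defensive.

Local Open Scope set_scope.
Local Open Scope nat_scope.

(* A tableau is the sequence of its rows, top row first. [rs_insert P k] is the
   pair formed by [P <- k] and the number of bumps made by this insertion. *)
Fixpoint rs_insert (P : seq (seq nat)) (k : nat) : seq (seq nat) * nat :=
  match P with
  | [::] => ([:: [:: k]], 0)
  | row :: P' =>
      if nilp row || (last 0 row <= k) then (rcons row k :: P', 0)
      else
        let j := find (fun y => k < y) row in
        let: (P'', b) := rs_insert P' (nth 0 row j) in
        (set_nth 0 row j k :: P'', b.+1)
  end.

(* The state carries the current insertion tableau and the number of bumps made
   so far; the recording tableau has no influence on either. *)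
Definition rs_step (st : seq (seq nat) * nat) (k : nat) : seq (seq nat) * nat :=
  let: (P', b) := rs_insert st.1 k in (P', st.2 + b).

(* ['I_n] is {0, ..., n-1}: [i : 'I_n] stands for the integer [i.+1]. *)
Definition one_line n (pi : 'S_n) : seq nat := [seq (pi i).+1 | i <- enum 'I_n].

Definition rs_bump n (pi : 'S_n) : nat := (foldl rs_step ([::], 0) (one_line pi)).2.

Definition plane_point (R : realType) n (p : 'I_n * 'I_n) : R * R :=
  ((p.1.+1)%:R%R, (p.2.+1)%:R%R).

Definition shadow (R : realType) n (G : {set 'I_n * 'I_n}) : set (R * R) :=
  [set z | exists2 p, p \in G &
     ((plane_point R p).1 <= z.1)%R /\ ((plane_point R p).2 <= z.2)%R]%classic.

(* The topological boundary of the shadow, in the real plane. *)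
Definition first_shadow_line (R : realType) n (G : {set 'I_n * 'I_n}) :
    set (R * R) :=
  (closure (shadow G) `\` interior (shadow G))%classic.

Definition on_first_line (R : realType) n (G : {set 'I_n * 'I_n}) :
    {set 'I_n * 'I_n} :=
  [set p in G | `[< first_shadow_line G (plane_point R p) >] ].

(* The points of [G] left after removing those on the first [k] shadow lines;
   the shadow line number [k.+1] of [G] is the first one of [remaining R k G]. *)
Definition remaining (R : realType) n (k : nat) (G : {set 'I_n * 'I_n}) :
    {set 'I_n * 'I_n} :=
  iter k (fun H => H :\: on_first_line R H) G.

(* If [L] is {(x_1, y_1), ..., (x_m, y_m)} with x_1 < ... < x_m, these are the
   points (x_(j+1), y_j). *)
Definition corners n (L : {set 'I_n * 'I_n}) : {set 'I_n * 'I_n} :=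
  [set z | [exists p in L, exists q in L,
     [&& p.1 < q.1, ~~ [exists t in L, p.1 < t.1 < q.1] & z == (q.1, p.2)]]].

Definition intermediate_points (R : realType) n (G : {set 'I_n * 'I_n}) :
    {set 'I_n * 'I_n} :=
  [set z | `[< exists k, z \in corners (on_first_line R (remaining R k G)) >] ].

(* G_r, for [r >= 1]. *)
Definition shadow_points (R : realType) n (pi : 'S_n) (r : nat) :
    {set 'I_n * 'I_n} :=
  iter r.-1 (@intermediate_points R n) [set (i, pi i) | i : 'I_n].

Lemma remaining_sub (R : realType) n k (G : {set 'I_n * 'I_n}) :
  remaining R k G \subset G.
Proof.
elim: k => [|k IH] //=.
by apply: fintype.subset_trans IH; apply: finset.subsetDl.
Qed.

Lemma card_abscissae (R : realType) n (G : {set 'I_n * 'I_n}) :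
  #|[set p.1 | p in intermediate_points R G]| <= #|[set p.1 | p in G]|.-1.
Proof.
have sub k p : p \in on_first_line R (remaining R k G) -> p \in G.
  by rewrite inE => /andP[/(fintype.subsetP (remaining_sub R k G))].
case: (set_0Vmem G) => [G0|[p0 p0G]].
  suff -> : intermediate_points R G = finset.set0 by rewrite finset.imset0 cards0.
  apply/setP => z; rewrite !inE; apply/negbTE/negP => /asboolP[k].
  by rewrite inE => /existsP[p /andP[/sub]]; rewrite G0 inE.
have [m mG mmin] := arg_minnP (fun p : 'I_n * 'I_n => p.1 : nat) p0G.
have mX : m.1 \in [set p.1 | p in G] by apply: imset_f.
suff /subset_leq_card : [set p.1 | p in intermediate_points R G]
    \subset [set p.1 | p in G] :\ m.1.
  by move/leq_trans; apply; rewrite [X in _ <= X.-1](cardsD1 m.1) mX.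
apply/fintype.subsetP => x /imsetP[z]; rewrite inE => /asboolP[k].
rewrite inE => /existsP[p /andP[/sub pG /existsP[q /andP[/sub qG]]]].
move=> /and3P[pq _ /eqP->] -> /=; rewrite !inE imset_f // andbT.
by apply: contraTneq pq => ->; rewrite -leqNgt; apply: mmin.
Qed.

(* The process stops: the shadows of rank greater than [n] are all empty. *)
Lemma shadow_points_eq0 (R : realType) n (pi : 'S_n) r :
  n < r -> shadow_points R pi r = finset.set0.
Proof.
have H k : #|[set p.1 | p in shadow_points R pi k.+1]| <= n - k.
  elim: k => [|k IH]; first by rewrite subn0 -[n in _ <= n]card_ord max_card.
  apply: leq_trans (card_abscissae _ _) _.
  by rewrite -/(shadow_points R pi k.+1) subnS -!subn1 leq_sub2r.
case: r => // r; rewrite ltnS => nr.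
have := H r; rewrite (eqP nr) leqn0 cards_eq0 => /eqP E.
apply/setP => p; rewrite inE; apply/negP => /(imset_f (fun p => p.1)).
by rewrite E inE.
Qed.

(* Main.v *)
Require Import Defs.
From mathcomp Require Import all_boot all_order all_algebra all_fingroup.
From mathcomp Require Import all_classical all_reals topology normedtype.

(** The bumps made in row 1 of the insertion tableau are the intermediate points
    of G_1. When the value y leaves row 1 because the entry of abscissa x is
    inserted, record the point (x, y). Row 2 is then built by inserting the
    recorded ordinates in the order of their abscissae, exactly as row 1 is
    built from the permutation; so if the recorded points are those of G_2, the
    recorded points of row 2 are those of G_3, and so on, and the total number of
    bumps is the sum of the numbers of intermediate points. The bookkeeping is
    [word_bumps_bumped]: the bumps of a word are those of row 1 plus those of the
    word of the recorded points.

    That the recorded points of row 1 are the intermediate points ([mem_bumped])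
    is seen by looking at the row one cell at a time. The first cell receives, in
    turn, the left-to-right minima of the ordinates and lets all other values
    pass to the rest of the row. Over points listed from west to east with
    distinct ordinates, the left-to-right minima are the points with no other
    point to their south-west, that is, the points of the first shadow line
    ([lists_minima]). Two successive contents of the cell, brought by p and then
    by q, give the recorded point (abscissa of q, ordinate of p), the corner of
    the line between p and q. The rest of the row is fed the points that remain
    once the first shadow line is removed, so induction yields the corners of the
    other lines.

    The geometric input is [mem_on_first_line]: for a finite set G, being on the
    topological boundary of the shadow means, for a point of G, that no point of
    G is strictly south-west of it. *)

Set Implicit Arguments.
Unset Strict Implicit.
Unset Printing Implicit Defensive.

Import Order.TTheory GRing.Theory Num.Theory numFieldNormedType.Exports.

Local Open Scope nat_scope.

(** * The first shadow line *)

(** A point of G lies in its shadow, so the question is when it is interior. It is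
    when some point of G is strictly south-west of it; conversely, if it is
    interior, moving it slightly to the south-west stays in the shadow, which
    provides such a point of G. *)
Lemma mem_on_first_line (R : realType) n (G : {set 'I_n * 'I_n}) p :
  (p \in on_first_line R G) =
  (p \in G) && ~~ [exists q in G, (q.1 < p.1) && (q.2 < p.2)].
Proof.
rewrite inE; case: (boolP (p \in G)) => //= pG.
apply/asboolP/idP => [[_ pNint]|/existsPn noSW].
  apply/existsP => -[q /andP[qG /andP[q1 q2]]]; apply: pNint.
  (* Coordinates are integers: the unit ball around p stays north-east of q. *)
  apply/nbhs_ballP; exists 1%R => //= -[a b] [/= Ha Hb].
  have le_ball (i j : 'I_n) (c : R) : i < j ->
      ball ((j.+1)%:R%R : R) 1%R c -> ((i.+1)%:R <= c)%R.
    rewrite -ball_normE /= ltr_norml => ij /andP[_].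
    rewrite ltrBlDr -natr1 addrC ltrD2l => jc.
    by apply: le_trans (ltW jc); rewrite ler_nat.
  by exists q => //; split; apply: le_ball; eassumption.
split.
  by apply: subset_closure; exists p => //; split; apply: lexx.
rewrite /interior /= => /nbhs_ballP[e /= e0 sub].
have e20 : (0 < e / 2)%R by rewrite divr_gt0.
have near_ball (c : R) : ball c e (c - e / 2)%R.
  rewrite -ball_normE /= opprB addrC subrK gtr0_norm //.
  by rewrite ltr_pdivrMr // ltr_pMr // ltr1n.
(* Half the radius, because balls are open. *)
have [|q qG [/= q1 q2]] := sub ((plane_point R p).1 - e / 2, (plane_point R p).2 - e / 2)%R.
  by split; apply: near_ball.
have lt_of_le (i j : 'I_n) : ((i.+1)%:R <= (j.+1)%:R - e / 2 :> R)%R -> i < j.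
  move=> ij; rewrite -ltnS -(ltr_nat R); apply: le_lt_trans ij _.
  by rewrite ltrBlDr ltrDl.
by have := noSW q; rewrite qG (lt_of_le _ _ q1) (lt_of_le _ _ q2).
Qed.

(** * Points listed from west to east *)

Definition west n : rel ('I_n * 'I_n) := fun p q => p.1 < q.1.

Lemma west_trans n : transitive (@west n).
Proof. by move=> q p r; apply: ltn_trans. Qed.

Lemma path_west n (p t : 'I_n * 'I_n) s :
  path (@west n) p s -> t \in s -> p.1 < t.1.
Proof. by rewrite (path_sortedE (@west_trans n)) => /andP[/allP h _] /h. Qed.

(** Distinct ordinates are part of the condition since row insertion and shadow
    lines treat ties differently: an inserted value goes past an equal entry,
    whereas a point due east of another one can be on the same shadow line.
    Distinct abscissae follow from the sorting. *)
Definition lists n (s : seq ('I_n * 'I_n)) (G : {set 'I_n * 'I_n}) : Prop :=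
  [/\ sorted (@west n) s, uniq [seq p.2 | p <- s] & s =i G].

(** * Bumps row by row *)

(** Insertion in one row with the bumped value, if any. The recursion moves along
    the cells of the row, so that the first cell can be isolated later. *)
Fixpoint row_insert n (r : seq 'I_n) (k : 'I_n) : seq 'I_n * option 'I_n :=
  match r with
  | [::] => ([:: k], None)
  | v :: r' => if k < v then (k :: r', Some v)
               else let: (r'', o) := row_insert r' k in (v :: r'', o)
  end.

(** The points (x, y) such that inserting the entry of abscissa x bumps y out of
    the row, whose initial content is [r]. *)
Fixpoint bumped n (r : seq 'I_n) (s : seq ('I_n * 'I_n)) : seq ('I_n * 'I_n) :=
  match s with
  | [::] => [::]
  | p :: s' => let: (r', o) := row_insert r p.2 in
               if o is Some y then (p.1, y) :: bumped r' s' else bumped r' s'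
  end.

Definition word n (s : seq ('I_n * 'I_n)) : seq nat := [seq p.2.+1 | p : 'I_n * 'I_n <- s].

Definition word_bumps (w : seq nat) : nat := (foldl rs_step ([::], 0) w).2.

Lemma foldl_rs_step_addn P b w :
  (foldl rs_step (P, b) w).2 = b + (foldl rs_step (P, 0) w).2.
Proof.
elim: w P b => [|k w IH] P b /=; first by rewrite addn0.
rewrite /rs_step /=; case: (rs_insert P k) => P' b' /=.
by rewrite IH [in RHS]IH addnA.
Qed.

Definition leo n : rel 'I_n := fun i j => i <= j.

Lemma row_insert_sorted n (r : seq 'I_n) k :
  sorted (@leo n) r -> sorted (@leo n) (row_insert r k).1.
Proof.
have pth (v : 'I_n) t :
    leo v k -> path (@leo n) v t -> path (@leo n) v (row_insert t k).1.
  elim: t v => [|u t IH] v vk /=; first by rewrite vk.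
  case: ltnP => [ku|uk] /= /andP[vu ut].
    rewrite vk /=; case: t ut {IH} => //= w t /andP[uw ->].
    by rewrite andbT /leo (leq_trans (ltnW ku)).
  by move: (IH u uk ut); case: (row_insert t k) => t' o /= ->; rewrite vu.
case: r => [|v r] //= vr.
case: ltnP => [kv|vk] /=.
  by case: r vr => //= w t /andP[vw ->]; rewrite andbT /leo (leq_trans (ltnW kv)).
by move: (pth v r vk vr); case: (row_insert r k).
Qed.

(** In a weakly increasing row, the comparison with the last entry decides whether
    some entry exceeds [k], so the search from left to right agrees with the
    case distinction made by [rs_insert]. *)
Lemma rs_insert_row n (r : seq 'I_n) (k : 'I_n) P :
  sorted (@leo n) r ->
  rs_insert ([seq y.+1 | y : 'I_n <- r] :: P) k.+1 =
  let: (r', o) := row_insert r k in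
  if o is Some y then
    let: (P', b) := rs_insert P y.+1 in ([seq y.+1 | y : 'I_n <- r'] :: P', b.+1)
  else ([seq y.+1 | y : 'I_n <- r'] :: P, 0).
Proof.
elim: r => [|v r IH] //= vr.
have le_last (u : 'I_n) t : path (@leo n) u t -> u < last u.+1 [seq y.+1 | y : 'I_n <- t].
  elim: t u => [|w t IHt] u //= /andP[uw /IHt wt]; exact: leq_ltn_trans uw wt.
have srt := path_sorted vr.
rewrite ltnS; case: ltnP => [kv|vk].
  by rewrite ifN // -ltnNge; apply: leq_ltn_trans kv (le_last _ _ vr).
move: (IH srt); case: r srt {vr IH le_last} => [|u r] srt.
  by rewrite /= ltnS vk.
case: (row_insert (u :: r) k) => r' [y|] /=; case: ifP => _.
- by case: (rs_insert P y.+1).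
- by case: (rs_insert P _) => P1 b1; case: (rs_insert P _) => P2 b2 [-> -> ->].
- by case=> ->.
- by case: (rs_insert P _).
Qed.

Lemma rs_stepE P b k :
  rs_step (P, b) k = ((rs_insert P k).1, b + (rs_insert P k).2).
Proof. by rewrite /rs_step; case: (rs_insert P k). Qed.

(** The rows below the first one evolve on their own, driven by the values bumped
    out of the first row. *)
Lemma foldl_rs_step_bumped n (r : seq 'I_n) (s : seq ('I_n * 'I_n)) P :
  sorted (@leo n) r ->
  (foldl rs_step ([seq y.+1 | y : 'I_n <- r] :: P, 0) (word s)).2 =
  size (bumped r s) + (foldl rs_step (P, 0) (word (bumped r s))).2.
Proof.
elim: s r P => [|p s IH] r P //= sr.
rewrite rs_stepE (rs_insert_row _ _ sr).
have := row_insert_sorted p.2 sr.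
case: (row_insert r p.2) => r' [y|] sr'; last exact: IH.
rewrite [word (_ :: _)]/= [foldl _ _ (_ :: _)]/= rs_stepE.
case: (rs_insert P y.+1) => P' b /=.
by rewrite foldl_rs_step_addn IH // [in RHS]foldl_rs_step_addn !add0n !addSn addnCA.
Qed.

Lemma word_bumps_bumped n (s : seq ('I_n * 'I_n)) :
  word_bumps (word s) = size (bumped [::] s) + word_bumps (word (bumped [::] s)).
Proof.
(* The empty tableau and the tableau with one empty row behave alike. *)
rewrite -(@foldl_rs_step_bumped _ [::] s [::]) //.
by case: s.
Qed.

(** * The first cell of a row *)

(** The entries that take the place of the content of a cell holding [v]: the
    left-to-right minima of the ordinates, starting from the bound [v]. *)
Fixpoint minima n (v : 'I_n) (s : seq ('I_n * 'I_n)) : seq ('I_n * 'I_n) :=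
  match s with
  | [::] => [::]
  | p :: s' => if p.2 < v then p :: minima p.2 s' else minima v s'
  end.

Fixpoint passed n (v : 'I_n) (s : seq ('I_n * 'I_n)) : seq ('I_n * 'I_n) :=
  match s with
  | [::] => [::]
  | p :: s' => if p.2 < v then passed p.2 s' else p :: passed v s'
  end.

Definition corner n (p q : 'I_n * 'I_n) : 'I_n * 'I_n := (q.1, p.2).

(** A value leaves the first cell when the next left-to-right minimum arrives.
    The content [v] has been brought by some earlier point, of ordinate [v]; its
    abscissa [x] is arbitrary because a corner only uses the ordinate of its left
    point. *)
Lemma mem_bumped_cons n (x v : 'I_n) r s :
  bumped (v :: r) s =i
    pairmap (@corner n) (x, v) (minima v s) ++ bumped r (passed v s).
Proof.
elim: s x v r => [|p s IH] x v r z //=.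
case: ltnP => [pv|vp] /=.
  by rewrite !in_cons (IH p.1) -surjective_pairing.
case: (row_insert r p.2) => r' [y|] /=; rewrite ?inE (IH x) !mem_cat //.
by rewrite inE orbCA.
Qed.

Lemma minima_subseq n (v : 'I_n) s : subseq (minima v s) s.
Proof.
elim: s v => [|p s IH] v //=; case: ltnP => _; first by rewrite eqxx.
exact: subseq_trans (IH v) (subseq_cons _ _).
Qed.

Lemma passed_subseq n (v : 'I_n) s : subseq (passed v s) s.
Proof.
elim: s v => [|p s IH] v //=; case: ltnP => _; last by rewrite eqxx.
exact: subseq_trans (IH _) (subseq_cons _ _).
Qed.

Lemma mem_passed n (v : 'I_n) s : uniq s ->
  forall p, (p \in passed v s) = (p \in s) && (p \notin minima v s).
Proof.
elim: s v => [|q s IH] v //= /andP[qs us] p.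
case: ltnP => _; rewrite !inE IH //; case: eqP => [->|] //=.
  by rewrite (negbTE qs).
by apply/esym; apply: contra qs => /(mem_subseq (minima_subseq _ _)).
Qed.

(** An entry is smaller than all earlier ones exactly when no point is south-west
    of it: being earlier is being further west, and by distinctness of the
    ordinates being not larger is being smaller. *)
Lemma mem_minima n (v : 'I_n) s :
  sorted (@west n) s -> uniq [seq p.2 | p <- s] ->
  forall p, (p \in minima v s) =
    [&& p \in s, p.2 < v & ~~ has (fun q : 'I_n * 'I_n => (q.1 < p.1) && (q.2 < p.2)) s].
Proof.
elim: s v => [|q s IH] v //= qs /andP[q2 us] p.
have srt := path_sorted qs.
have [pq|pNq] := eqVneq p q.
  have pNs u : p \in minima u s = false.
    apply/negP => /(mem_subseq (minima_subseq _ _)) /(map_f snd).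
    by rewrite pq (negbTE q2).
  have noSW : ~~ has (fun u : 'I_n * 'I_n => (u.1 < p.1) && (u.2 < p.2)) s.
    by apply/hasPn => u us'; rewrite negb_and -leqNgt pq ltnW // (path_west qs).
  rewrite negb_or noSW pq inE eqxx ltnn /= andbT.
  by case: ltnP => _; rewrite ?inE ?eqxx // -pq pNs.
have pin : (p \in q :: s) = (p \in s) by rewrite inE (negbTE pNq).
rewrite pin.
have [ps|pNs] := boolP (p \in s); last first.
  have pNm u : p \in minima u s = false.
    by apply: contraNF pNs => /(mem_subseq (minima_subseq _ _)).
  by case: ltnP => _; rewrite ?inE ?(negbTE pNq) pNm.
have q1 : q.1 < p.1 := path_west qs ps.
have p2q2 : (p.2 < q.2) = ~~ (q.2 < p.2).
  rewrite -leqNgt ltn_neqAle; case: (p.2 =P q.2) => [E|NE] /=.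
    by move: q2; rewrite -E map_f.
  by case: eqP => // /val_inj.
rewrite q1 /= negb_or -p2q2.
case: ltnP => [qv|vq]; rewrite ?inE ?(negbTE pNq) IH // ps /=.
  by case: (ltnP p.2 q.2) => [pq|_] /=; rewrite ?andbF // (ltn_trans pq qv).
by case: (ltnP p.2 v) => [pv|_] //=; rewrite (leq_trans pv vq).
Qed.

(** * Corners and intermediate points *)

Lemma mem_pairmap_corner n (p : 'I_n * 'I_n) l z : path (@west n) p l ->
  z \in pairmap (@corner n) p l <->
  exists u v, [/\ u \in p :: l, v \in p :: l, u.1 < v.1,
    forall t, t \in p :: l -> ~~ (u.1 < t.1 < v.1) & z = corner u v].
Proof.
elim: l p z => [|q l IH] p z pl /=.
  split=> // -[u [v [/[!inE]/eqP-> /eqP->]]].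
  by rewrite ltnn.
have [pq ql] := andP pl.
rewrite inE; split.
  case/orP => [/eqP->|/(IH _ _ ql)[u [v [uin vin uv noB ->]]]].
    exists p, q; split=> //; rewrite ?inE ?eqxx ?orbT //.
    move=> t; rewrite !inE => /or3P[/eqP->|/eqP->|tl]; rewrite ?ltnn ?andbF //.
    by rewrite negb_and orbC -leqNgt ltnW // (path_west ql).
  exists u, v; split=> //.
  - by rewrite in_cons uin orbT.
  - by rewrite in_cons vin orbT.
  move=> t; rewrite in_cons => /predU1P[->|]; last exact: noB.
  by rewrite negb_and -leqNgt ltnW // (path_west pl).
case=> u [v [uin vin uv noB ->]].
have vql : v \in q :: l.
  move: vin; rewrite in_cons => /predU1P[vp|//].
  move: uin; rewrite in_cons => /predU1P[up|uql].
    by move: uv; rewrite up vp ltnn.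
  by move: uv; rewrite ltnNge vp ltnW // (path_west pl).
move: uin; rewrite in_cons => /predU1P[up|uql].
  move: vql; rewrite in_cons => /predU1P[vq|vl]; first by rewrite up vq eqxx.
  have: ~~ (u.1 < q.1 < v.1) by apply: noB; rewrite !inE eqxx orbT.
  by rewrite up (pq : p.1 < q.1) (path_west ql vl).
apply/orP; right; apply/(IH _ _ ql); exists u, v; split=> // t tin.
by apply: noB; rewrite in_cons tin orbT.
Qed.

(** In a list sorted from west to east, the pairs of points of the set with no
    abscissa in between are the pairs of neighbours. *)
Lemma mem_corners n (p : 'I_n * 'I_n) l (L : {set 'I_n * 'I_n}) :
  path (@west n) p l -> p :: l =i L -> corners L =i pairmap (@corner n) p l.
Proof.
move=> pl pL z; rewrite inE; apply/idP/idP.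
  move=> /existsP[u /andP[uL /existsP[v /andP[vL /and3P[uv /existsPn noB /eqP->]]]]].
  apply/mem_pairmap_corner => //; exists u, v; rewrite !pL; split=> // t.
  by rewrite pL => tL; have := noB t; rewrite tL.
case/mem_pairmap_corner => // u [v [uin vin uv noB ->]].
apply/existsP; exists u; rewrite -pL uin; apply/existsP; exists v.
rewrite -pL vin uv eqxx andbT; apply/existsPn => t; rewrite -pL negb_and.
by case: (boolP (t \in _)) => // /noB.
Qed.

Lemma lists_minima (R : realType) n (p : 'I_n * 'I_n) s G :
  lists (p :: s) G -> p :: minima p.2 s =i on_first_line R G.
Proof.
move=> [/= ps /andP[p2 us] sG] u.
have srt := path_sorted ps.
rewrite mem_on_first_line -sG.
have -> : [exists q in G, (q.1 < u.1) && (q.2 < u.2)] =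
    has (fun q : 'I_n * 'I_n => (q.1 < u.1) && (q.2 < u.2)) (p :: s).
  apply/existsP/hasP => [[q /andP[qG h]]|[q qs h]]; exists q => //.
    by rewrite sG.
  by rewrite -sG qs.
rewrite !in_cons mem_minima //=; have [->|up] /= := eqVneq u p.
  rewrite !ltnn /=; apply/esym/hasPn => t ts.
  by rewrite negb_and -leqNgt ltnW // (path_west ps).
case: (boolP (u \in s)) => //= us'; rewrite (path_west ps us') /= negb_or -leqNgt.
congr (_ && _); rewrite ltn_neqAle; case: (u.2 =P p.2 :> nat) => //= E.
by move: p2; rewrite -(val_inj E) map_f.
Qed.

Lemma lists_passed (R : realType) n (p : 'I_n * 'I_n) s G :
  lists (p :: s) G -> lists (passed p.2 s) (G :\: on_first_line R G).
Proof.
move=> sG; have first := lists_minima R sG; case: sG => /= ps /andP[p2 us] sG.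
split.
- exact: (subseq_sorted (@west_trans n) (passed_subseq _ _) (path_sorted ps)).
- exact: subseq_uniq (map_subseq _ (passed_subseq _ _)) us.
move=> u; rewrite mem_passed ?(map_uniq us) // finset.in_setD -first -sG !in_cons negb_or.
case: (u =P p) => [->|_] /=; last exact: andbC.
by apply/negbTE; rewrite negb_and; apply/orP; left; apply: contra p2; apply: map_f.
Qed.

Lemma intermediate_pointsP (R : realType) n (G : {set 'I_n * 'I_n}) z :
  reflect (exists k, z \in corners (on_first_line R (remaining R k G)))
          (z \in intermediate_points R G).
Proof. rewrite inE; exact: asboolP. Qed.

Lemma intermediate_points_recl (R : realType) n (G : {set 'I_n * 'I_n}) :
  intermediate_points R G =
  corners (on_first_line R G) :|: intermediate_points R (G :\: on_first_line R G).
Proof.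
apply/setP => z; rewrite finset.in_setU; apply/intermediate_pointsP/orP.
  case=> -[|k] zk; [by left | right; apply/intermediate_pointsP].
  by exists k; rewrite /remaining -iterSr.
case=> [z0|/intermediate_pointsP[k zk]]; first by exists 0.
by exists k.+1; rewrite /remaining iterSr.
Qed.

Lemma intermediate_points0 (R : realType) n :
  intermediate_points R (finset.set0 : {set 'I_n * 'I_n}) = finset.set0.
Proof.
apply/setP => z; rewrite !inE; apply/negbTE/negP => /asboolP[k].
rewrite inE => /existsP[p /andP[]]; rewrite inE.
by move=> /andP[/(fintype.subsetP (remaining_sub R k _))]; rewrite inE.
Qed.

(** Cell by cell, the bumps out of a row are the corners of the successive shadow
    lines: [mem_bumped_cons] and [intermediate_points_recl] split off the first
    cell and the first line, and what remains on both sides corresponds. *)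
Lemma mem_bumped (R : realType) n s (G : {set 'I_n * 'I_n}) :
  lists s G -> bumped [::] s =i intermediate_points R G.
Proof.
have [m] := ubnP (size s); elim: m s G => // m IH [|p s] G /= sm sG z.
  suff -> : G = finset.set0 by rewrite intermediate_points0 finset.in_set0.
  by apply/finset.setP => u; case: sG => _ _ <-; rewrite finset.in_set0.
have pth : path (@west n) p (minima p.2 s).
  have [/= ps _ _] := sG.
  exact: (subseq_path (@west_trans n) (minima_subseq _ _) ps).
rewrite (mem_bumped_cons p.1) -surjective_pairing mem_cat intermediate_points_recl.
rewrite finset.in_setU (mem_corners pth (lists_minima R sG)); congr (_ || _).
apply: IH; last exact: lists_passed.
rewrite ltnS in sm; apply: leq_ltn_trans sm; exact/size_subseq/passed_subseq.
Qed.

Lemma bumped_abscissae n (r : seq 'I_n) s :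
  subseq [seq p.1 | p <- bumped r s] [seq p.1 | p <- s].
Proof.
elim: s r => [|p s IH] r //=.
case: (row_insert r p.2) => r' [y|]; first by rewrite /= eqxx.
exact: subseq_trans (IH _) (subseq_cons _ _).
Qed.

(** Insertion only moves values: the new row and the bumped value are the old row
    and the inserted value. Hence bumped ordinates inherit distinctness. *)
Lemma count_row_insert n (r : seq 'I_n) k a :
  oapp a false (row_insert r k).2 + count a (row_insert r k).1 = a k + count a r.
Proof.
elim: r => [|v r IH] //=.
case: ltnP => _ /=; first by rewrite addnCA.
by move: IH; case: (row_insert r k) => r' o /= IH; rewrite addnCA IH addnCA.
Qed.

Lemma count_bumped_ordinates n (r : seq 'I_n) s a :
  count a [seq p.2 | p <- bumped r s] <= count a r + count a [seq p.2 | p <- s].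
Proof.
elim: s r => [|p s IH] r //=.
rewrite addnCA addnA -count_row_insert.
by case: (row_insert r p.2) => r' [y|] //=; rewrite -addnA leq_add2l.
Qed.

(** What makes the iteration possible: the bumped points come out in the order
    in which they enter the next row. *)
Lemma lists_bumped (R : realType) n s (G : {set 'I_n * 'I_n}) :
  lists s G -> lists (bumped [::] s) (intermediate_points R G).
Proof.
move=> sG; have [srt us _] := sG; split; last exact: mem_bumped.
- have fstE (t : seq ('I_n * 'I_n)) :
      sorted (@west n) t = sorted ltn [seq val i | i <- [seq p.1 | p <- t]].
    by rewrite !sorted_map.
  move: srt; rewrite !fstE; apply: subseq_sorted; first exact: ltn_trans.
  exact/map_subseq/bumped_abscissae.
apply: count_mem_uniq => y; rewrite -has_pred1 has_count.
have: count_mem y [seq p.2 | p <- bumped [::] s] <= 1.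
  apply: leq_trans (count_bumped_ordinates _ _ _) _.
  by rewrite add0n count_uniq_mem // leq_b1.
by case: (count_mem y _) => [|[]].
Qed.

(** * Bumps and shadows *)

Lemma lists_graph n (pi : 'S_n) :
  lists [seq (i, pi i) | i <- enum 'I_n] [set (i, pi i) | i : 'I_n].
Proof.
split.
- rewrite sorted_map (eq_sorted (e' := relpre val ltn)) // -sorted_map.
  by rewrite val_enum_ord iota_ltn_sorted.
- by rewrite -map_comp map_inj_uniq ?enum_uniq //; apply: perm_inj.
move=> z; apply/mapP/imsetP => -[i _ ->]; exists i => //.
by rewrite mem_enum.
Qed.

Lemma word_bumps_shadows (R : realType) n s (G : {set 'I_n * 'I_n}) m :
  lists s G -> iter m (@intermediate_points R n) G = finset.set0 ->
  word_bumps (word s) =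
  \sum_(0 <= k < m) #|intermediate_points R (iter k (@intermediate_points R n) G)|.
Proof.
elim: m s G => [|m IH] s G sG.
  move=> /= G0; rewrite big_geq //; case: s sG => // p s [_ _ /(_ p)].
  by rewrite G0 !inE eqxx.
rewrite iterSr => G0; have bG := lists_bumped R sG.
rewrite word_bumps_bumped big_nat_recl //= (IH _ _ bG G0); congr (_ + _).
  have [_ /map_uniq/card_uniqP <- bE] := bG; exact: eq_card.
by apply: eq_bigr => k _; rewrite -iterSr.
Qed.

Theorem proposition7 (R : realType) (n : nat) (hn : (0 < n)%N) (pi : 'S_n) :
  rs_bump pi =
    (\sum_(1 <= r < n.+1) #|intermediate_points R (shadow_points R pi r)|)%N.
Proof.
rewrite big_add1 -(word_bumps_shadows (lists_graph pi)).
  by rewrite /rs_bump /word_bumps /word -map_comp.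
exact: (@shadow_points_eq0 R n pi n.+1).
Qed.
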